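(* Let $G$ be an affine game. Then $G$ is invertible if and only if $G$ is a Conway game. Moreover, if $G$ is a Conway game, then $G+(-G)=0$, where $-G$ is the conjugate of $G$.
   Context: Affine games are defined recursively. There are two games without options, denoted $\infty$ and $\overline{\infty}$ (terminating games). Every other affine game is a form $G=\{G^{\mathcal L}\mid G^{\mathcal R}\}$, where $G^{\mathcal L}$ (Left options) and $G^{\mathcal R}$ (Right options) are non-empty finite sets of previously constructed affine games. Let $\mathbb A$ be the set of all affine games. The game $0$ is $\{\overline\infty\mid\infty\}$. The followers of $G$ are $G$ itself and all games reachable from $G$ by a finite sequence of (not necessarily alternating) moves to options. Disjunctive sum: $G+H$ is undefined if one of $G,H$ is the form $\infty$ and the other is $\overline\infty$; it is $\infty$ if one is $\infty$ and the other is not $\overline\infty$; it is $\overline\infty$ if one is $\overline\infty$ and the other is not $\infty$; otherwise $G+H=\{G^{\mathcal L}+H,\,G+H^{\mathcal L}\mid G^{\mathcal R}+H,\,G+H^{\mathcal R}\}$. Outcomes: $o^L(G)=\mathbf L$ if $G=\infty$ or some $G^L\in G^{\mathcal L}$ has $o^R(G^L)=\mathbf L$, and $o^L(G)=\mathbf R$ otherwise; $o^R(G)=\mathbf R$ if $G=\overline\infty$ or some $G^R\in G^{\mathcal R}$ has $o^L(G^R)=\mathbf R$, and $o^R(G)=\mathbf L$ otherwise; $o(G)=(o^L(G),o^R(G))$. Equality of games: $G=H$ iff $o(G+X)=o(H+X)$ for all $X\in\mathbb A\setminus\{\infty,\overline\infty\}$. Conjugate: $-\infty=\overline\infty$, $-\overline\infty=\infty$,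 and otherwise $-G=\{-G^{\mathcal R}\mid -G^{\mathcal L}\}$ (conjugating each option). $G$ is invertible if there is an affine game $H$ with $G+H$ defined and $G+H=0$ (equality of games). A game is a check if $\infty$ is one of its Left options or $\overline\infty$ is one of its Right options. A Conway form is an affine game form that is neither $\infty$ nor $\overline\infty$ and has no checks among its followers. A Conway game is an affine game equal (as a game) to some Conway form. *)

(* Defs.v *)
From Stdlib Require Import List.
Import ListNotations.

(* [Inf] is the infinity sign, [NInf] is the overlined one.  The finite
   non-empty option sets are presented by lists, split into a head and a tail so
   that non-emptiness holds by construction; a set has several presentations,
   but every notion below depends only on which options occur in the lists. *)
Inductive game : Type :=
| Inf
| NInf
| Form (l : game) (ls : list game) (r : game) (rs : list game).

Definition left_options (G : game) : list game :=
  match G with Form l ls _ _ => l :: ls | _ => [] end.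

Definition right_options (G : game) : list game :=
  match G with Form _ _ r rs => r :: rs | _ => [] end.

Definition zero : game := Form NInf [] Inf [].

Definition terminating (G : game) : Prop := G = Inf \/ G = NInf.

Inductive follower (G : game) : game -> Prop :=
| follower_refl : follower G G
| follower_left K K' :
    follower G K -> In K' (left_options K) -> follower G K'
| follower_right K K' :
    follower G K -> In K' (right_options K) -> follower G K'.

Definition sum_defined (G H : game) : Prop :=
  ~ (G = Inf /\ H = NInf) /\ ~ (G = NInf /\ H = Inf).

(* The value of [add G H] is the disjunctive sum only when [sum_defined G H];
   otherwise it is a junk value ([Inf]).  The recursive calls never
   meet the undefined case, since one summand is always a [Form]. *)
Fixpoint add (G : game) : game -> game :=
  fix addG (H : game) : game :=
    match G, H with
    | Inf, _ | _, Inf => Inf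
    | NInf, _ | _, NInf => NInf
    | Form l ls r rs, Form l' ls' r' rs' =>
        Form (add l H) (map (fun K => add K H) ls ++ map addG (l' :: ls'))
             (add r H) (map (fun K => add K H) rs ++ map addG (r' :: rs'))
    end.

Fixpoint conjugate (G : game) : game :=
  match G with
  | Inf => NInf
  | NInf => Inf
  | Form l ls r rs =>
      Form (conjugate r) (map conjugate rs) (conjugate l) (map conjugate ls)
  end.

Inductive player : Type := Left | Right.

Definition is_Left (p : player) : bool :=
  match p with Left => true | Right => false end.

Definition is_Right (p : player) : bool := negb (is_Left p).

Fixpoint outcomeL (G : game) : player :=
  match G with
  | Inf => Left
  | NInf => Right
  | Form l ls _ _ =>
      if existsb (fun K => is_Left (outcomeR K)) (l :: ls) then Left else Right
  end
with outcomeR (G : game) : player :=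
  match G with
  | Inf => Left
  | NInf => Right
  | Form _ _ r rs =>
      if existsb (fun K => is_Right (outcomeL K)) (r :: rs) then Right else Left
  end.

Definition outcome (G : game) : player * player := (outcomeL G, outcomeR G).

Definition game_eq (G H : game) : Prop :=
  forall X : game, ~ terminating X -> outcome (add G X) = outcome (add H X).

Definition invertible (G : game) : Prop :=
  exists H : game, sum_defined G H /\ game_eq (add G H) zero.

Definition check (G : game) : Prop :=
  In Inf (left_options G) \/ In NInf (right_options G).

Definition conway_form (G : game) : Prop :=
  ~ terminating G /\ forall K : game, follower G K -> ~ check K.

Definition conway_game (G : game) : Prop :=
  exists F : game, conway_form F /\ game_eq G F.

(* Main.v *)
(* A game equals 0 exactly when the second player wins it, so G is invertible
   iff G + H is a second-player win for some H.  For a Conway form the mirror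
   strategy wins F + (-F).  Conversely, if G + H is a second-player win, bypassing
   reversible options and deleting dominated ones gives a smaller equal form.
   When neither G nor H can be shrunk in this way, the winning answer to a Left
   move to A <> NInf in G + H is a move to some C in H with A + C again a
   second-player win; by induction on size every such A equals a Conway form, and
   replacing the options of G by these forms gives a Conway form equal to G. *)

Require Import Defs.
From Stdlib Require Import List Lia.
Import ListNotations.

(** * Induction on options and the options of a sum *)

(** The tails of the option sets are lists nested in [game], so the hypothesis must reach each of
    their members; the inner inductions on [ls] and [rs] keep every call of [IH] on a structural
    subterm. *)
Lemma game_option_ind (P : game -> Prop) :
  (forall G, (forall K, In K (left_options G) -> P K) ->
             (forall K, In K (right_options G) -> P K) -> P G) ->
  forall G, P G.
Proof.
  intros step. fix IH 1. intros G. apply step.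
  - destruct G as [| |l ls r rs]; simpl; try contradiction.
    intros K [<-|HK]; [apply IH|].
    revert K HK. induction ls as [|x xs IHxs]; simpl; [contradiction|].
    intros K [<-|HK]; [apply IH|exact (IHxs K HK)].
  - destruct G as [| |l ls r rs]; simpl; try contradiction.
    intros K [<-|HK]; [apply IH|].
    revert K HK. induction rs as [|x xs IHxs]; simpl; [contradiction|].
    intros K [<-|HK]; [apply IH|exact (IHxs K HK)].
Qed.

Lemma not_terminating_Form l ls r rs : ~ terminating (Form l ls r rs).
Proof. intros [?|?]; discriminate. Qed.

Lemma terminating_dec (G : game) : {terminating G} + {~ terminating G}.
Proof.
  destruct G; [left; now left|left; now right|right; apply not_terminating_Form].
Qed.

Lemma left_option_not_terminating G K :
  In K (left_options G) -> ~ terminating G.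
Proof. intros HK [->| ->]; exact HK. Qed.

Lemma right_option_not_terminating G K :
  In K (right_options G) -> ~ terminating G.
Proof. intros HK [->| ->]; exact HK. Qed.

(** Reduces syntactic equality of sums and conjugates to equality of option lists, where the [map]
    lemmas apply. *)
Lemma game_ext G H :
  ~ terminating G -> ~ terminating H ->
  left_options G = left_options H -> right_options G = right_options H -> G = H.
Proof.
  unfold terminating.
  destruct G, H; simpl; intros; try tauto; congruence.
Qed.

Lemma add_Inf_l G : add Inf G = Inf.
Proof. now destruct G. Qed.

Lemma add_Inf_r G : add G Inf = Inf.
Proof. now destruct G. Qed.

Lemma add_NInf_l G : G <> Inf -> add NInf G = NInf.
Proof. now destruct G. Qed.

Lemma add_NInf_r G : G <> Inf -> add G NInf = NInf.
Proof. now destruct G. Qed.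

Lemma not_terminating_Inf G : ~ terminating G -> G <> Inf.
Proof. unfold terminating; tauto. Qed.

Lemma not_terminating_NInf G : ~ terminating G -> G <> NInf.
Proof. unfold terminating; tauto. Qed.

#[local] Hint Resolve not_terminating_Inf not_terminating_NInf
  not_terminating_Form left_option_not_terminating
  right_option_not_terminating : core.

Lemma add_not_terminating G H :
  ~ terminating (add G H) <-> ~ terminating G /\ ~ terminating H.
Proof.
  unfold terminating.
  destruct G, H; simpl; intuition discriminate.
Qed.

Lemma left_options_add G H :
  ~ terminating G -> ~ terminating H ->
  left_options (add G H) =
    map (fun K => add K H) (left_options G) ++ map (add G) (left_options H).
Proof. unfold terminating. destruct G, H; try tauto. Qed.

Lemma right_options_add G H :
  ~ terminating G -> ~ terminating H ->
  right_options (add G H) =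
    map (fun K => add K H) (right_options G) ++ map (add G) (right_options H).
Proof. unfold terminating. destruct G, H; try tauto. Qed.

Lemma in_left_options_add G H K :
  In K (left_options (add G H)) <->
  ~ terminating G /\ ~ terminating H /\
  ((exists G', In G' (left_options G) /\ K = add G' H) \/
   (exists H', In H' (left_options H) /\ K = add G H')).
Proof.
  split.
  - intros HK.
    assert (N := left_option_not_terminating _ _ HK).
    apply add_not_terminating in N as [NG NH].
    rewrite left_options_add, in_app_iff, !in_map_iff in HK by easy.
    firstorder.
  - intros (NG & NH & HK).
    rewrite left_options_add, in_app_iff, !in_map_iff by easy.
    firstorder.
Qed.

Lemma in_right_options_add G H K :
  In K (right_options (add G H)) <->
  ~ terminating G /\ ~ terminating H /\
  ((exists G', In G' (right_options G) /\ K = add G' H) \/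
   (exists H', In H' (right_options H) /\ K = add G H')).
Proof.
  split.
  - intros HK.
    assert (N := right_option_not_terminating _ _ HK).
    apply add_not_terminating in N as [NG NH].
    rewrite right_options_add, in_app_iff, !in_map_iff in HK by easy.
    firstorder.
  - intros (NG & NH & HK).
    rewrite right_options_add, in_app_iff, !in_map_iff by easy.
    firstorder.
Qed.

(* Holds without definedness hypotheses, because the junk value [Inf] absorbs
   everything. *)
Lemma add_assoc A B C : add (add A B) C = add A (add B C).
Proof.
  revert B C.
  induction A as [A IHAl IHAr] using game_option_ind.
  induction B as [B IHBl IHBr] using game_option_ind.
  induction C as [C IHCl IHCr] using game_option_ind.
  destruct (terminating_dec A) as [[->| ->]|NA].
  { now rewrite !add_Inf_l. }
  { now destruct B, C. }
  destruct (terminating_dec B) as [[->| ->]|NB].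
  { now rewrite add_Inf_r, !add_Inf_l, add_Inf_r. }
  { now destruct A, C. }
  destruct (terminating_dec C) as [[->| ->]|NC].
  { now rewrite !add_Inf_r. }
  { now destruct A, B. }
  assert (NAB : ~ terminating (add A B)) by now apply add_not_terminating.
  assert (NBC : ~ terminating (add B C)) by now apply add_not_terminating.
  apply game_ext.
  - now apply add_not_terminating.
  - now apply add_not_terminating.
  - rewrite !left_options_add, !map_app, !map_map, <- app_assoc by easy.
    f_equal; [|f_equal]; apply map_ext_in; auto.
  - rewrite !right_options_add, !map_app, !map_map, <- app_assoc by easy.
    f_equal; [|f_equal]; apply map_ext_in; auto.
Qed.

(** * Conjugation and its interaction with sums *)

Lemma conjugate_involutive G : conjugate (conjugate G) = G.
Proof.
  induction G as [G IHl IHr] using game_option_ind.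
  destruct G as [| |l ls r rs]; simpl; try easy.
  simpl in IHl, IHr.
  rewrite !map_map, IHl, IHr by now left.
  f_equal; rewrite <- map_id; apply map_ext_in; auto.
Qed.

Lemma left_options_conjugate G :
  left_options (conjugate G) = map conjugate (right_options G).
Proof. now destruct G. Qed.

Lemma right_options_conjugate G :
  right_options (conjugate G) = map conjugate (left_options G).
Proof. now destruct G. Qed.

Lemma conjugate_not_terminating G :
  ~ terminating (conjugate G) <-> ~ terminating G.
Proof. unfold terminating. destruct G; simpl; intuition discriminate. Qed.

(** Definedness matters: the junk value [Inf] of an undefined sum conjugates to [NInf], while the
    sum of the conjugates is again [Inf]. *)
Lemma conjugate_add G H :
  sum_defined G H -> conjugate (add G H) = add (conjugate G) (conjugate H).
Proof.
  revert H.
  induction G as [G IHGl IHGr] using game_option_ind.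
  induction H as [H IHHl IHHr] using game_option_ind.
  intros D.
  destruct (terminating_dec G) as [TG|NG].
  { destruct TG as [->| ->], H; unfold sum_defined in D; simpl; tauto. }
  destruct (terminating_dec H) as [TH|NH].
  { destruct TH as [->| ->], G; unfold sum_defined in D; simpl; tauto. }
  assert (NG' := proj2 (conjugate_not_terminating G) NG).
  assert (NH' := proj2 (conjugate_not_terminating H) NH).
  apply game_ext.
  - apply conjugate_not_terminating. now apply add_not_terminating.
  - now apply add_not_terminating.
  - rewrite left_options_conjugate, left_options_add, right_options_add,
      !left_options_conjugate, map_app, !map_map by easy.
    f_equal; apply map_ext_in; intros K HK;
      [apply IHGr|apply IHHr]; unfold sum_defined, terminating in *; tauto.
  - rewrite right_options_conjugate, left_options_add, right_options_add,
      !right_options_conjugate, map_app, !map_map by easy.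
    f_equal; apply map_ext_in; intros K HK;
      [apply IHGl|apply IHHl]; unfold sum_defined, terminating in *; tauto.
Qed.

Lemma sum_defined_not_terminating G H : ~ terminating G -> sum_defined G H.
Proof. unfold sum_defined, terminating. tauto. Qed.

(** * Outcomes as statements about winning moves *)

Lemma outcomeL_Left G :
  outcomeL G = Left <->
  G = Inf \/ exists K, In K (left_options G) /\ outcomeR K = Left.
Proof.
  destruct G as [| |l ls r rs].
  - simpl; tauto.
  - simpl. split; [discriminate|]. intros [?|(K & [] & _)]; discriminate.
  - change (outcomeL (Form l ls r rs)) with
      (if existsb (fun K => is_Left (outcomeR K)) (l :: ls) then Left else Right).
    change (left_options (Form l ls r rs)) with (l :: ls).
    assert (E := existsb_exists (fun K => is_Left (outcomeR K)) (l :: ls)).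
    destruct (existsb _ _).
    + split; [intros _; right|easy].
      destruct (proj1 E eq_refl) as (K & HK & e).
      exists K. split; [easy|]. now destruct (outcomeR K).
    + split; [discriminate|]. intros [?|(K & HK & e)]; [discriminate|].
      assert (false = true); [|discriminate].
      apply E. exists K. now rewrite e.
Qed.

Lemma outcomeR_Right G :
  outcomeR G = Right <->
  G = NInf \/ exists K, In K (right_options G) /\ outcomeL K = Right.
Proof.
  destruct G as [| |l ls r rs].
  - simpl. split; [discriminate|]. intros [?|(K & [] & _)]; discriminate.
  - simpl; tauto.
  - change (outcomeR (Form l ls r rs)) with
      (if existsb (fun K => is_Right (outcomeL K)) (r :: rs) then Right else Left).
    change (right_options (Form l ls r rs)) with (r :: rs).
    assert (E := existsb_exists (fun K => is_Right (outcomeL K)) (r :: rs)).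
    destruct (existsb _ _).
    + split; [intros _; right|easy].
      destruct (proj1 E eq_refl) as (K & HK & e).
      exists K. split; [easy|]. now destruct (outcomeL K).
    + split; [discriminate|]. intros [?|(K & HK & e)]; [discriminate|].
      assert (false = true); [|discriminate].
      apply E. exists K. now rewrite e.
Qed.

Lemma player_dec (p : player) : p = Left \/ p = Right.
Proof. destruct p; auto. Qed.

(** The universal form of a win for Left moving second: no Right move refutes it. Strategy arguments
    below verify this form. *)
Lemma outcomeR_Left G :
  outcomeR G = Left <->
  G <> NInf /\ forall K, In K (right_options G) -> outcomeL K = Left.
Proof.
  assert (E := outcomeR_Right G). split.
  - intros e. split.
    + intros ->. discriminate.
    + intros K HK. destruct (player_dec (outcomeL K)) as [|e']; [easy|].
      rewrite (proj2 E) in e; [discriminate|eauto].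
  - intros [N HK]. destruct (player_dec (outcomeR G)) as [|e]; [easy|].
    apply E in e as [?|(K & I & e)]; [easy|]. rewrite HK in e; easy.
Qed.

(** Conjugation swaps the players. Both halves go through one induction because [outcomeL] and
    [outcomeR] are mutually recursive. *)
Lemma outcome_conjugate G :
  (outcomeL (conjugate G) = Left <-> outcomeR G = Right) /\
  (outcomeR (conjugate G) = Left <-> outcomeL G = Right).
Proof.
  induction G as [G IHl IHr] using game_option_ind. split.
  - rewrite outcomeL_Left, outcomeR_Right, left_options_conjugate.
    apply Morphisms_Prop.or_iff_morphism.
    + destruct G; simpl; intuition discriminate.
    + split.
      * intros (K & HK & e). apply in_map_iff in HK as (K' & <- & HK).
        exists K'. split; [easy|]. now apply IHr.
      * intros (K & HK & e). exists (conjugate K).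
        split; [now apply in_map|]. now apply IHr.
  - rewrite outcomeR_Left, right_options_conjugate.
    destruct (player_dec (outcomeL G)) as [e|e]; rewrite e.
    + split; [|discriminate]. intros [N HK]. exfalso.
      apply outcomeL_Left in e as [->|(K & I & e)]; [now apply N|].
      specialize (HK (conjugate K) (in_map conjugate _ _ I)).
      apply IHl in HK; [congruence|easy].
    + split; [easy|]. intros _. split.
      * destruct G; simpl in *; congruence.
      * intros K HK. apply in_map_iff in HK as (K' & <- & HK).
        apply IHl; [easy|].
        destruct (player_dec (outcomeR K')) as [e'|]; [|easy].
        rewrite (proj2 (outcomeL_Left G)) in e; [discriminate|eauto].
Qed.

(** * Comparing outcomes of sums *)

(** Left's preference order: [H] is at least as good for Left as [G], whoever starts. *)
Definition outcome_le (G H : game) : Prop :=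
  (outcomeL G = Left -> outcomeL H = Left) /\
  (outcomeR G = Left -> outcomeR H = Left).

Lemma outcome_le_trans G H K :
  outcome_le G H -> outcome_le H K -> outcome_le G K.
Proof. unfold outcome_le. tauto. Qed.

Lemma outcome_le_antisym G H :
  outcome_le G H -> outcome_le H G -> outcome G = outcome H.
Proof.
  unfold outcome_le, outcome. intros [a b] [c d].
  f_equal.
  - destruct (outcomeL G), (outcomeL H); intuition congruence.
  - destruct (outcomeR G), (outcomeR H); intuition congruence.
Qed.

Lemma outcome_eq_le G H : outcome G = outcome H -> outcome_le G H.
Proof. unfold outcome_le, outcome. intros [= -> ->]. tauto. Qed.

(** [add] lists the options of its first argument first, so exchanging the summands changes the
    term; commutativity is therefore stated for outcomes. *)
Lemma outcome_le_add_comm G H : outcome_le (add G H) (add H G).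
Proof.
  revert H.
  induction G as [G IHGl IHGr] using game_option_ind.
  induction H as [H IHHl IHHr] using game_option_ind.
  split.
  - rewrite !outcomeL_Left. intros [e|(K & HK & e)].
    + left. now destruct G, H.
    + right. apply in_left_options_add in HK as
        (NG & NH & [(K' & HK & ->)|(K' & HK & ->)]).
      * exists (add H K'). split; [apply in_left_options_add; eauto 6|].
        now apply IHGl.
      * exists (add K' G). split; [apply in_left_options_add; eauto 6|].
        now apply IHHl.
  - rewrite !outcomeR_Left. intros [N F]. split.
    + now destruct G, H.
    + intros K HK. apply in_right_options_add in HK as
        (NH & NG & [(K' & HK & ->)|(K' & HK & ->)]).
      * apply IHHr; [easy|]. apply F, in_right_options_add; eauto 6.
      * apply IHGr; [easy|]. apply F, in_right_options_add; eauto 6.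
Qed.

Lemma outcome_add_comm G H : outcome (add G H) = outcome (add H G).
Proof. apply outcome_le_antisym; apply outcome_le_add_comm. Qed.

(* Left answers each Right move in the component where it was made. *)
Lemma outcome_le_add_r Z Y : outcomeR Y = Left -> outcome_le Z (add Z Y).
Proof.
  (* The second conjunct strengthens the induction to the position just after Right has moved in
     [Y], with Left to reply there. *)
  enough ((outcomeR Y = Left -> outcome_le Z (add Z Y)) /\
          (outcomeL Y = Left -> outcomeR Z = Left -> outcomeL (add Z Y) = Left))
    by tauto.
  revert Y.
  induction Z as [Z IHZl IHZr] using game_option_ind.
  induction Y as [Y IHYl IHYr] using game_option_ind.
  destruct (terminating_dec Z) as [[->| ->]|NZ].
  { rewrite add_Inf_l. easy. }
  { unfold outcome_le; simpl; intuition discriminate. }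
  destruct (terminating_dec Y) as [[->| ->]|NY].
  { rewrite add_Inf_r. easy. }
  { unfold outcome_le; simpl; intuition discriminate. }
  split; [intros eY; split|].
  - intros eZ. apply outcomeL_Left in eZ as [->|(K & HK & e)];
      [now rewrite add_Inf_l|].
    apply outcomeL_Left. right. exists (add K Y).
    split; [apply in_left_options_add; eauto 6|].
    now apply (proj1 (IHZl K HK Y) eY).
  - intros eZ. apply outcomeR_Left. split.
    { now apply not_terminating_NInf, add_not_terminating. }
    intros K HK. apply in_right_options_add in HK as
      (_ & _ & [(K' & HK & ->)|(K' & HK & ->)]).
    + apply (proj1 (IHZr K' HK Y) eY). apply outcomeR_Left in eZ. now apply eZ.
    + apply (proj2 (IHYr K' HK)); [|easy].
      apply outcomeR_Left in eY. now apply eY.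
  - intros eY eZ. apply outcomeL_Left in eY as [->|(K & HK & e)];
      [now rewrite add_Inf_r|].
    apply outcomeL_Left. right. exists (add Z K).
    split; [apply in_left_options_add; eauto 6|].
    now apply (proj1 (IHYl K HK) e).
Qed.

(** Follows from [outcome_le_add_r] by conjugating; a terminating [Z] is treated directly, since
    [conjugate_add] asks for a defined sum. *)
Lemma outcome_add_le_r Z Y : outcomeL Y = Right -> outcome_le (add Z Y) Z.
Proof.
  intros eY.
  assert (eY' := proj2 (proj2 (outcome_conjugate Y)) eY).
  destruct (outcome_le_add_r (conjugate Z) _ eY') as [M1 M2].
  assert (NY : Y <> Inf) by (intros ->; discriminate).
  destruct (terminating_dec Z) as [[->| ->]|NZ].
  { easy. }
  { rewrite add_NInf_l by easy. easy. }
  rewrite <- conjugate_add in M1, M2 by now apply sum_defined_not_terminating.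
  rewrite !(proj1 (outcome_conjugate _)) in M1.
  rewrite !(proj2 (outcome_conjugate _)) in M2.
  split; intros e.
  - destruct (player_dec (outcomeL Z)) as [|e']; [easy|].
    apply M2 in e'. congruence.
  - destruct (player_dec (outcomeR Z)) as [|e']; [easy|].
    apply M1 in e'. congruence.
Qed.

(** * Second-player wins and equality with zero *)

Definition second_player_win (G : game) : Prop :=
  outcomeL G = Right /\ outcomeR G = Left.

Lemma second_player_win_outcome G H :
  outcome G = outcome H -> second_player_win G -> second_player_win H.
Proof. unfold outcome, second_player_win. intros [= -> ->]. easy. Qed.

(** Adding a second-player win [Y] can neither harm nor help Left, so it changes no outcome; [zero]
    is itself such a game. *)
Lemma second_player_win_game_eq_zero G :
  second_player_win G <-> game_eq G zero.
Proof.
  assert (E : forall Y X, second_player_win Y -> outcome (add Y X) = outcome X).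
  { intros Y X [eL eR]. rewrite outcome_add_comm.
    apply outcome_le_antisym.
    - now apply outcome_add_le_r.
    - now apply outcome_le_add_r. }
  split.
  - intros W X _. now rewrite !E.
  (* Testing the equality on [zero] suffices: adding [zero] preserves outcomes, so [G] has the
     outcome of [zero]. *)
  - intros Q. specialize (Q zero (not_terminating_Form _ _ _ _)).
    rewrite outcome_add_comm, !E in Q by easy.
    now apply (second_player_win_outcome _ _ (eq_sym Q)).
Qed.

Lemma second_player_win_not_terminating G :
  second_player_win G -> ~ terminating G.
Proof. intros [a b] [->| ->]; discriminate. Qed.

Lemma second_player_win_add_comm G H :
  second_player_win (add G H) -> second_player_win (add H G).
Proof. apply second_player_win_outcome, outcome_add_comm. Qed.

Lemma second_player_win_conjugate G :
  second_player_win G -> second_player_win (conjugate G).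
Proof.
  intros [a b]. split.
  - destruct (player_dec (outcomeL (conjugate G))) as [e|]; [|easy].
    apply outcome_conjugate in e. congruence.
  - now apply outcome_conjugate.
Qed.

Lemma second_player_win_conjugate_add G H :
  second_player_win (add G H) ->
  second_player_win (add (conjugate G) (conjugate H)).
Proof.
  intros W.
  assert (N := second_player_win_not_terminating _ W).
  apply add_not_terminating in N as [NG NH].
  rewrite <- conjugate_add by now apply sum_defined_not_terminating.
  now apply second_player_win_conjugate.
Qed.

(** Definedness comes for free: a second-player win is not terminating, hence neither are its
    summands. *)
Lemma invertible_second_player_win G :
  invertible G <-> exists H, second_player_win (add G H).
Proof.
  unfold invertible. split.
  - intros (H & _ & Q). exists H. now apply second_player_win_game_eq_zero.
  - intros (H & W). exists H. split.
    + apply sum_defined_not_terminating.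
      now apply second_player_win_not_terminating, add_not_terminating in W.
    + now apply second_player_win_game_eq_zero.
Qed.

(** * Conway forms and the mirror strategy *)

Lemma follower_trans G K M : follower G K -> follower K M -> follower G M.
Proof.
  intros HGK HKM. induction HKM as [|M M' _ IH I|M M' _ IH I];
    [easy|now apply (follower_left _ M)|now apply (follower_right _ M)].
Qed.

Lemma conway_form_follower F K :
  conway_form F -> follower F K -> ~ terminating K -> conway_form K.
Proof.
  intros [_ C] HK N. split; [easy|]. intros M HM.
  apply C. now apply (follower_trans _ K).
Qed.

Lemma conway_form_left F K :
  conway_form F -> In K (left_options F) -> K = NInf \/ conway_form K.
Proof.
  intros C HK. destruct (terminating_dec K) as [[->|e]|N]; [|now left|right].
  - destruct C as [_ C]. exfalso.
    apply (C F); [apply follower_refl|now left].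
  - apply (conway_form_follower F); [easy| |easy].
    now apply (follower_left _ F); [apply follower_refl|].
Qed.

Lemma conway_form_right F K :
  conway_form F -> In K (right_options F) -> K = Inf \/ conway_form K.
Proof.
  intros C HK. destruct (terminating_dec K) as [[e| ->]|N]; [now left| |right].
  - destruct C as [_ C]. exfalso.
    apply (C F); [apply follower_refl|now right].
  - apply (conway_form_follower F); [easy| |easy].
    now apply (follower_right _ F); [apply follower_refl|].
Qed.

(** [follower] extends a play at its end; this splits off the first move instead, as a recursion on
    options requires. *)
Lemma follower_inv G K :
  follower G K ->
  K = G \/ exists O, (In O (left_options G) \/ In O (right_options G)) /\
                     follower O K.
Proof.
  induction 1 as [|K K' _ IH I|K K' _ IH I]; [now left|..]; right;
    destruct IH as [->|(O & HO & F)].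
  - exists K'. split; [now left|apply follower_refl].
  - exists O. split; [easy|]. now apply (follower_left _ K).
  - exists K'. split; [now right|apply follower_refl].
  - exists O. split; [easy|]. now apply (follower_right _ K).
Qed.

(** Recursive description of Conway forms: a terminating option is harmless exactly when it loses
    for the player moving to it, and it has no further followers. *)
Lemma conway_form_intro F :
  ~ terminating F ->
  (forall K, In K (left_options F) -> K = NInf \/ conway_form K) ->
  (forall K, In K (right_options F) -> K = Inf \/ conway_form K) ->
  conway_form F.
Proof.
  intros N HL HR. split; [easy|]. intros K HK.
  apply follower_inv in HK as [->|(O & HO & HK)].
  - intros [I|I].
    + apply HL in I as [|[N' _]]; [discriminate|now apply N'; left].
    + apply HR in I as [|[N' _]]; [discriminate|now apply N'; right].
  - assert (T : terminating O \/ conway_form O).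
    { destruct HO as [HO|HO]; [apply HL in HO|apply HR in HO];
        destruct HO as [->|]; [left; now right|now right|left; now left|now right]. }
    destruct T as [T|[_ C]]; [|now apply C].
    apply follower_inv in HK as [->|(O' & [I|I] & _)].
    + destruct T as [->| ->]; intros [I|I]; exact I.
    + now apply left_option_not_terminating in I.
    + now apply right_option_not_terminating in I.
Qed.

(* Mirror strategy: without checks, every non-losing move can be copied in the
   other component. *)
Lemma conway_form_add_conjugate F :
  conway_form F -> second_player_win (add F (conjugate F)).
Proof.
  intros C.
  assert (E : outcomeR (add F (conjugate F)) = Left).
  { induction F as [F IHl IHr] using game_option_ind.
    assert (N := proj1 C).
    assert (N' := proj2 (conjugate_not_terminating F) N).
    apply outcomeR_Left. split.
    { now apply not_terminating_NInf, add_not_terminating. }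
    intros K HK. apply in_right_options_add in HK as
      (_ & _ & [(K' & HK & ->)|(K' & HK & ->)]).
    - destruct (conway_form_right F K' C HK) as [->|CK].
      { now rewrite add_Inf_l. }
      apply outcomeL_Left. right. exists (add K' (conjugate K')).
      split; [|now apply IHr].
      apply in_left_options_add. split; [apply CK|]. split; [easy|].
      right. exists (conjugate K'). split; [|easy].
      rewrite left_options_conjugate. now apply in_map.
    - rewrite right_options_conjugate in HK.
      apply in_map_iff in HK as (M & <- & HK).
      destruct (conway_form_left F M C HK) as [->|CM].
      { simpl. now rewrite add_Inf_r. }
      apply outcomeL_Left. right. exists (add M (conjugate M)).
      split; [|now apply IHl].
      apply in_left_options_add. split; [easy|].
      split; [now apply conjugate_not_terminating, CM|].
      left. now exists M. }
  split; [|easy].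
  (* [F + (-F)] conjugates to [(-F) + F], which has the same outcomes, so the case of Left starting
     follows from [E]. *)
  apply outcome_conjugate.
  rewrite conjugate_add, conjugate_involutive
    by now apply sum_defined_not_terminating, C.
  now apply outcome_le_add_comm.
Qed.

(** * Equality of games under conjugation and in sums *)

Lemma game_eq_sym G H : game_eq G H -> game_eq H G.
Proof. intros Q X N. now rewrite Q. Qed.

Lemma game_eq_trans G H K : game_eq G H -> game_eq H K -> game_eq G K.
Proof. intros Q Q' X N. now rewrite Q, Q'. Qed.

Lemma game_eq_conjugate G H :
  game_eq G H -> game_eq (conjugate G) (conjugate H).
Proof.
  intros Q X N.
  assert (N' := proj2 (conjugate_not_terminating X) N).
  (* Every test game is a conjugate, so testing [-G] and [-H] on [X] amounts to testing [G] and [H]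
     on [-X]. *)
  rewrite <- (conjugate_involutive X).
  rewrite <- !conjugate_add
    by (split; intros [_ e]; apply N'; rewrite e; [now right|now left]).
  specialize (Q _ N'). unfold outcome in Q. injection Q as e1 e2.
  assert (O := outcome_conjugate (add G (conjugate X))).
  assert (O' := outcome_conjugate (add H (conjugate X))).
  rewrite e1, e2 in O.
  apply outcome_le_antisym; unfold outcome_le; tauto.
Qed.

Lemma second_player_win_game_eq G H X :
  game_eq G H -> second_player_win (add G X) -> second_player_win (add H X).
Proof.
  intros Q W. apply (second_player_win_outcome (add G X)); [|easy].
  apply Q. now apply second_player_win_not_terminating, add_not_terminating in W.
Qed.

(** Starts from [F + (-F)] for an equal Conway form [F] and replaces the summands one at a time. *)
Lemma conway_game_add_conjugate G :
  conway_game G -> second_player_win (add G (conjugate G)).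
Proof.
  intros (F & C & Q).
  assert (W : second_player_win (add G (conjugate F))).
  { apply (second_player_win_game_eq F); [now apply game_eq_sym|].
    now apply conway_form_add_conjugate. }
  apply second_player_win_add_comm.
  apply (second_player_win_game_eq (conjugate F)).
  - now apply game_eq_conjugate, game_eq_sym.
  - now apply second_player_win_add_comm.
Qed.

(** * The order on games and how to establish it *)

Definition game_le (G H : game) : Prop :=
  forall X, ~ terminating X -> outcome_le (add G X) (add H X).

Lemma game_le_antisym G H : game_le G H -> game_le H G -> game_eq G H.
Proof. intros a b X N. apply outcome_le_antisym; auto. Qed.

Lemma game_eq_le G H : game_eq G H -> game_le G H.
Proof. intros Q X N. now apply outcome_eq_le, Q. Qed.

(* [B <= B + (H + G) = (B + H) + G <= G], using [H + G >= 0 >= B + H]. *)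
Lemma game_le_cancel B H G :
  outcomeL (add B H) = Right -> outcomeR (add H G) = Left -> game_le B G.
Proof.
  intros eBH eHG X N.
  apply (outcome_le_trans _ (add X B)); [apply outcome_le_add_comm|].
  apply (outcome_le_trans _ (add (add X B) (add H G)));
    [now apply outcome_le_add_r|].
  apply (outcome_le_trans _ (add (add G X) (add B H)));
    [|now apply outcome_add_le_r].
  (* Both sides regroup around [add X (add B H)] and then differ by a single exchange with [G]. *)
  rewrite <- (add_assoc (add X B) H G), (add_assoc X B H), (add_assoc G X).
  apply outcome_le_add_comm.
Qed.

(** Induction on the test game [X] disposes of moves in [X], leaving conditions on moves in [G] and
    [G']. The Left condition may use the claim already known at Left options of [X], which bypassing
    a reversible move requires. *)
Lemma game_le_intro G G' :
  ~ terminating G -> ~ terminating G' ->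
  (forall X, ~ terminating X ->
     (forall X', In X' (left_options X) ->
        outcomeR (add G X') = Left -> outcomeR (add G' X') = Left) ->
     forall K, In K (left_options G) ->
       outcomeR (add K X) = Left -> outcomeL (add G' X) = Left) ->
  (forall K', In K' (right_options G') ->
     exists K, In K (right_options G) /\ game_le K K') ->
  game_le G G'.
Proof.
  intros NG NG' HL HR X.
  induction X as [X IHl IHr] using game_option_ind. intros NX. split.
  - intros e. apply outcomeL_Left in e as [e|(K & HK & e)].
    { exfalso. revert e.
      now apply not_terminating_Inf, add_not_terminating. }
    assert (IH : forall X', In X' (left_options X) ->
        outcomeR (add G X') = Left -> outcomeR (add G' X') = Left).
    { intros X' I. destruct (terminating_dec X') as [[->| ->]|N].
      - now rewrite !add_Inf_r.
      - now rewrite !add_NInf_r by auto.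
      - now apply IHl. }
    apply in_left_options_add in HK as
      (_ & _ & [(K' & HK & ->)|(K' & HK & ->)]).
    + now apply (HL X NX IH K').
    + apply outcomeL_Left. right. exists (add G' K').
      split; [apply in_left_options_add; eauto 6|]. now apply IH.
  - intros e. apply outcomeR_Left in e as [_ e]. apply outcomeR_Left. split.
    { now apply not_terminating_NInf, add_not_terminating. }
    intros K HK. apply in_right_options_add in HK as
      (_ & _ & [(K' & HK & ->)|(K' & HK & ->)]).
    + destruct (HR K' HK) as (K & I & M). apply M; [easy|].
      apply e, in_right_options_add; eauto 6.
    + assert (e' : outcomeL (add G K') = Left).
      { apply e, in_right_options_add; eauto 6. }
      destruct (terminating_dec K') as [[->| ->]|N].
      * now rewrite add_Inf_r.
      * rewrite add_NInf_r in e' by auto. discriminate.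
      * now apply IHr.
Qed.

Lemma game_le_refl G : game_le G G.
Proof. intros X N. easy. Qed.

Lemma outcomeL_add_left G X K :
  ~ terminating G -> ~ terminating X ->
  In K (left_options G) -> outcomeR (add K X) = Left ->
  outcomeL (add G X) = Left.
Proof.
  intros NG NX I e. apply outcomeL_Left. right. exists (add K X).
  split; [apply in_left_options_add; eauto 6|easy].
Qed.

(** * Bypassing reversible options and deleting dominated ones *)

(** Simplified forms carry [NInf] in the head slot to keep the Left option set non-empty. The
    padding is harmless: moving to it loses for Left, as [NInf] absorbs [X]. *)
Lemma in_Form_NInf l r rs K X :
  ~ terminating X -> In K (left_options (Form NInf l r rs)) ->
  outcomeR (add K X) = Left -> In K l.
Proof.
  intros N [<-|I] e; [|easy].
  rewrite add_NInf_l in e by auto. discriminate.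
Qed.

Lemma game_eq_bypass_reversible l ls r rs l1 A l2 B :
  l :: ls = l1 ++ A :: l2 ->
  In B (right_options A) -> B <> Inf -> game_le B (Form l ls r rs) ->
  game_eq (Form l ls r rs) (Form NInf (l1 ++ left_options B ++ l2) r rs).
Proof.
  intros options_split HB NB BG. set (G := Form l ls r rs) in *.
  assert (HG : forall K, In K (left_options G) <-> In K (l1 ++ A :: l2))
    by (unfold G; simpl left_options; now rewrite options_split).
  set (G' := Form NInf (l1 ++ left_options B ++ l2) r rs).
  assert (NG' : ~ terminating G') by apply not_terminating_Form.
  apply game_le_antisym; apply game_le_intro;
    try apply not_terminating_Form.
  - intros X NX IH K HK e.
    apply HG, in_app_or in HK. destruct HK as [HK|[<-|HK]].
    + apply (outcomeL_add_left _ _ K); try easy; try apply not_terminating_Form.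
      right. rewrite !in_app_iff. tauto.
    + apply outcomeR_Left in e as [_ e].
      assert (eB : outcomeL (add B X) = Left)
        by (apply e, in_right_options_add; eauto 8).
      apply outcomeL_Left in eB as [eB|(K & HK & eB)].
      * exfalso.
        destruct B, X; try discriminate; try easy; apply NX; now left.
      * apply in_left_options_add in HK as
          (NB' & _ & [(K' & HK & ->)|(K' & HK & ->)]).
        -- apply (outcomeL_add_left _ _ K'); try easy;
             try apply not_terminating_Form.
           right. rewrite !in_app_iff. tauto.
        (* Left plays in [X] at once: the win in [B + K'] passes to [G + K'] and, by [IH], to
           [G' + K']. *)
        -- apply outcomeL_Left. right. exists (add G' K').
           split; [apply in_left_options_add; eauto 8|].
           apply IH; [easy|].
           destruct (terminating_dec K') as [[->| ->]|N].
           ++ now rewrite add_Inf_r.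
           ++ rewrite add_NInf_r in eB by easy. discriminate.
           ++ now apply BG.
    + apply (outcomeL_add_left _ _ K); try easy; try apply not_terminating_Form.
      right. rewrite !in_app_iff. tauto.
  - intros K HK. exists K. split; [easy|apply game_le_refl].
  - intros X NX _ K HK e.
    apply in_Form_NInf with (X := X) in HK; [|easy..].
    rewrite !in_app_iff in HK.
    assert (I : In K (left_options G) \/ In K (left_options B)).
    { rewrite HG, in_app_iff. simpl. tauto. }
    destruct I as [I|I].
    + apply (outcomeL_add_left _ _ K); try easy. apply not_terminating_Form.
    + apply BG; [easy|]. apply (outcomeL_add_left _ _ K); eauto.
  - intros K HK. exists K. split; [easy|apply game_le_refl].
Qed.

Lemma game_eq_remove_dominated l ls r rs l1 A l2 A' :
  l :: ls = l1 ++ A :: l2 ->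
  In A' (l1 ++ l2) -> game_le A A' ->
  game_eq (Form l ls r rs) (Form NInf (l1 ++ l2) r rs).
Proof.
  intros options_split HA' AA'. set (G := Form l ls r rs).
  assert (HG : forall K, In K (left_options G) <-> In K (l1 ++ A :: l2))
    by (unfold G; simpl left_options; now rewrite options_split).
  apply game_le_antisym; apply game_le_intro;
    try apply not_terminating_Form.
  - intros X NX _ K HK e.
    assert (I : In K (l1 ++ l2) \/ A = K).
    { apply HG in HK. rewrite in_app_iff in *. simpl in HK. tauto. }
    destruct I as [I|<-].
    + apply (outcomeL_add_left _ _ K); try apply not_terminating_Form;
        try easy; now right.
    + apply (outcomeL_add_left _ _ A'); try apply not_terminating_Form;
        try easy; [now right|now apply AA'].
  - intros K HK. exists K. split; [easy|apply game_le_refl].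
  - intros X NX _ K HK e.
    apply in_Form_NInf with (X := X) in HK; [|easy..].
    apply (outcomeL_add_left _ _ K); try apply not_terminating_Form;
      try easy.
    apply HG. rewrite in_app_iff in *. simpl. tauto.
  - intros K HK. exists K. split; [easy|apply game_le_refl].
Qed.

(** * Size and reducibility *)

(** Terminating games have size 0, so padding with [NInf] costs nothing. *)
Fixpoint size (G : game) : nat :=
  match G with
  | Inf | NInf => 0
  | Form l ls r rs =>
      S (list_sum (size l :: map size ls) + list_sum (size r :: map size rs))
  end.

Lemma size_options G :
  ~ terminating G ->
  size G = S (list_sum (map size (left_options G)) +
              list_sum (map size (right_options G))).
Proof. unfold terminating. destruct G; tauto. Qed.

Lemma size_Form_split l ls r rs l1 A l2 :
  l :: ls = l1 ++ A :: l2 ->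
  size (Form l ls r rs) =
    S (list_sum (map size l1) + size A + list_sum (map size l2) +
       list_sum (map size (r :: rs))).
Proof.
  intros E. rewrite size_options by apply not_terminating_Form.
  cbn [left_options right_options].
  rewrite E, map_app, list_sum_app. simpl. lia.
Qed.

Lemma size_Form_NInf l r rs :
  size (Form NInf l r rs) =
    S (list_sum (map size l) + list_sum (map size (r :: rs))).
Proof. reflexivity. Qed.

Lemma in_list_sum_size K l : In K l -> size K <= list_sum (map size l).
Proof.
  induction l as [|x l IH]; simpl; [easy|].
  intros [->|I]; [lia|]. specialize (IH I). lia.
Qed.

Lemma size_left_option G K : In K (left_options G) -> size K < size G.
Proof.
  intros I. rewrite (size_options G) by eauto.
  apply in_list_sum_size in I. lia.
Qed.

Lemma size_right_option G K : In K (right_options G) -> size K < size G.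
Proof.
  intros I. rewrite (size_options G) by eauto.
  apply in_list_sum_size in I. lia.
Qed.

Lemma size_conjugate G : size (conjugate G) = size G.
Proof.
  induction G as [G IHl IHr] using game_option_ind.
  destruct (terminating_dec G) as [[->| ->]|N]; try easy.
  rewrite !size_options by now rewrite ?conjugate_not_terminating.
  rewrite left_options_conjugate, right_options_conjugate, !map_map.
  rewrite (map_ext_in _ _ _ IHl), (map_ext_in _ _ _ IHr). lia.
Qed.

Definition reducible (G : game) : Prop :=
  exists G', size G' < size G /\ game_eq G G'.

Lemma reducible_conjugate G : reducible (conjugate G) -> reducible G.
Proof.
  intros (G' & S & Q). exists (conjugate G'). split.
  - now rewrite size_conjugate, <- (size_conjugate G).
  - rewrite <- (conjugate_involutive G). now apply game_eq_conjugate.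
Qed.

(** The Left options of [B] have total size at most that of [B], which is smaller than that of the
    replaced [A]. *)
Lemma reducible_of_reversible G A B :
  In A (left_options G) -> In B (right_options A) -> B <> Inf ->
  game_le B G -> reducible G.
Proof.
  intros HA HB NB BG.
  assert (N := left_option_not_terminating _ _ HA).
  destruct G as [| |l ls r rs]; try now destruct HA.
  change (left_options (Form l ls r rs)) with (l :: ls) in HA.
  destruct (in_split _ _ HA) as (l1 & l2 & E).
  exists (Form NInf (l1 ++ left_options B ++ l2) r rs). split.
  - rewrite (size_Form_split _ _ _ _ _ _ _ E), size_Form_NInf.
    rewrite !map_app, !list_sum_app.
    assert (SA := size_right_option _ _ HB).
    assert (SB : list_sum (map size (left_options B)) <= size B)
      by (destruct B; simpl; lia).
    lia.
  - now apply (game_eq_bypass_reversible _ _ _ _ _ A).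
Qed.

(** * Options of a pair of mutually inverse games *)

(** Traces Right's winning reply to [A] and, if it lies in [H], Left's winning answer to that same
    move from [G + H]. Each course of play exhibits a reversible option, a dominated option, or the
    desired [C]. The disjunction keeps the argument constructive. *)
Lemma not_reducible_left_option G H A :
  second_player_win (add G H) -> In A (left_options G) ->
  (reducible G \/ reducible H) \/
  (A = NInf \/ exists C, In C (right_options H) /\ second_player_win (add A C)).
Proof.
  intros W HA.
  assert (N := second_player_win_not_terminating _ W).
  apply add_not_terminating in N as [NG NH].
  assert (eA : outcomeR (add A H) = Right).
  { destruct (player_dec (outcomeR (add A H))) as [e|]; [|easy].
    destruct W as [W _].
    rewrite (outcomeL_add_left G H A) in W by easy. discriminate. }
  apply outcomeR_Right in eA as [eA|(K & HK & eK)].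
  { right; left. destruct A, H; try discriminate; try easy.
    exfalso; apply NH; now right. }
  apply in_right_options_add in HK as
    (NA & _ & [(B & HB & ->)|(C & HC & ->)]).
  (* Right replies inside [A]: [B + H <= 0 <= H + G] gives [B <= G], so [A] is reversible through
     [B]. *)
  { left; left. apply (reducible_of_reversible G A B); try easy.
    - intros ->. rewrite add_Inf_l in eK. discriminate.
    - apply (game_le_cancel B H G); [easy|].
      apply second_player_win_add_comm, W. }
  (* Right could also open [G + H] with [C], so Left has a winning move in [G + C]. *)
  assert (eC : outcomeL (add G C) = Left).
  { destruct W as [_ W]. apply outcomeR_Left in W as [_ W].
    apply W, in_right_options_add; eauto 6. }
  apply outcomeL_Left in eC as [eC|(K & HK & eC)].
  { assert (C = Inf) as ->.
    { destruct G, C; try discriminate; try easy; exfalso; apply NG; now left. }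
    rewrite add_Inf_r in eK. discriminate. }
  apply in_left_options_add in HK as
    (_ & NC & [(A' & HA' & ->)|(D & HD & ->)]).
  (* From [A + C <= 0 <= C + A'], the option [A'] dominates [A]. *)
  - assert (AA' : game_le A A').
    { apply (game_le_cancel A C A'); [easy|].
      now apply outcome_le_add_comm. }
    destruct G as [| |l ls r rs]; try now destruct HA.
    change (left_options (Form l ls r rs)) with (l :: ls) in HA, HA'.
    destruct (in_split _ _ HA) as (l1 & l2 & E).
    assert (I : In A' (l1 ++ l2) \/ A = A').
    { rewrite E, in_app_iff in HA'. rewrite in_app_iff. simpl in HA'. tauto. }
    destruct I as [I| <-].
    + left; left. exists (Form NInf (l1 ++ l2) r rs). split.
      * rewrite (size_Form_split _ _ _ _ _ _ _ E), size_Form_NInf.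
        (* The decrease is strict because [A] is not terminating. *)
        assert (0 < size A) by (rewrite size_options by easy; lia).
        rewrite map_app, list_sum_app. lia.
      * now apply (game_eq_remove_dominated _ _ _ _ _ A _ A').
    (* With [A'] equal to [A], [eK] and [eC] are the two halves of the second-player win [A + C]. *)
    + right; right. now exists C.
  (* Left answers inside [C]: in [-H] the Left option [-C] is reversible through [-D], by the same
     cancellation. *)
  - left; right. apply reducible_conjugate.
    apply (reducible_of_reversible _ (conjugate C) (conjugate D)).
    + rewrite left_options_conjugate. now apply in_map.
    + rewrite right_options_conjugate. now apply in_map.
    + intros eD. assert (D = NInf) as -> by now destruct D.
      rewrite add_NInf_r in eC by auto. discriminate.
    + apply (game_le_cancel _ (conjugate G)).
      * rewrite <- conjugate_add.
        -- destruct (player_dec (outcomeL (conjugate (add D G)))) as [e|]; [|easy].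
           apply outcome_conjugate in e.
           apply outcome_le_add_comm in eC. congruence.
        -- split; intros [_ ->]; apply NG; [now right|now left].
      * now apply second_player_win_conjugate_add.
Qed.

(** Makes a pointwise alternative over a finite list uniform, without excluded middle. *)
Lemma forall_or_exceptional {T : Type} (P : Prop) (Q : T -> Prop) (l : list T) :
  (forall x, In x l -> P \/ Q x) -> P \/ forall x, In x l -> Q x.
Proof.
  induction l as [|x l IH]; intros HPQ; [now right|].
  destruct (HPQ x (or_introl eq_refl)) as [|q]; [now left|].
  destruct IH as [|q'].
  { intros y I. apply HPQ. now right. }
  - now left.
  - right. intros y [<-|I]; auto.
Qed.

Lemma not_reducible_options G H :
  second_player_win (add G H) ->
  (reducible G \/ reducible H) \/
  (forall A, In A (left_options G) ->
     A = NInf \/ exists C, In C (right_options H) /\ second_player_win (add A C)) /\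
  (forall A, In A (right_options G) ->
     A = Inf \/ exists C, In C (left_options H) /\ second_player_win (add A C)).
Proof.
  intros W.
  destruct (forall_or_exceptional _ _ _
    (fun A => not_reducible_left_option G H A W)) as [|HL]; [now left|].
  (* Right options of [G] are the conjugates of Left options of [-G], and [-G + (-H)] is again a
     second-player win. *)
  assert (W' := second_player_win_conjugate_add _ _ W).
  destruct (forall_or_exceptional _ _ _
    (fun A => not_reducible_left_option _ _ A W')) as [R|HR].
  { left. destruct R as [R|R]; apply reducible_conjugate in R; tauto. }
  right. split; [easy|]. intros A HA.
  destruct (HR (conjugate A)) as [e|(C & HC & WC)].
  - rewrite left_options_conjugate. now apply in_map.
  - left. now destruct A.
  - right. rewrite right_options_conjugate in HC.
    apply in_map_iff in HC as (C' & <- & HC).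
    exists C'. split; [easy|].
    apply second_player_win_conjugate_add in WC.
    now rewrite !conjugate_involutive in WC.
Qed.

(** * Replacing options by Conway forms *)

(** Each winning move is matched by the move to the equal option of the other form. *)
Lemma game_eq_options G G' :
  ~ terminating G -> ~ terminating G' ->
  Forall2 game_eq (left_options G) (left_options G') ->
  Forall2 game_eq (right_options G) (right_options G') ->
  game_eq G G'.
Proof.
  assert (E : forall l l', Forall2 game_eq l l' ->
    (forall K, In K l -> exists K', In K' l' /\ game_eq K K') /\
    (forall K', In K' l' -> exists K, In K l /\ game_eq K K')).
  { induction 1 as [|x y l l' Q _ [IH1 IH2]]; [easy|]. split.
    - intros K [<-|I]; [exists y; simpl; auto|].
      destruct (IH1 K I) as (K' & I' & Q'). exists K'. simpl; auto.
    - intros K [<-|I]; [exists x; simpl; auto|].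
      destruct (IH2 K I) as (K' & I' & Q'). exists K'. simpl; auto. }
  intros N N' HL HR.
  apply E in HL as [HL1 HL2]. apply E in HR as [HR1 HR2].
  apply game_le_antisym; apply game_le_intro; try easy.
  - intros X NX _ K HK e. destruct (HL1 K HK) as (K' & I & Q).
    apply (outcomeL_add_left _ _ K'); try easy.
    now apply (game_eq_le _ _ Q).
  - intros K HK. destruct (HR2 K HK) as (K' & I & Q).
    exists K'. split; [easy|]. now apply game_eq_le.
  - intros X NX _ K HK e. destruct (HL2 K HK) as (K' & I & Q).
    apply (outcomeL_add_left _ _ K'); try easy.
    now apply (game_eq_le _ _ (game_eq_sym _ _ Q)).
  - intros K HK. destruct (HR1 K HK) as (K' & I & Q).
    exists K'. split; [easy|]. now apply game_eq_le, game_eq_sym.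
Qed.

Lemma Forall2_choice {T U : Type} (R : T -> U -> Prop) (Q : U -> Prop) l :
  (forall x, In x l -> exists y, Q y /\ R x y) ->
  exists l', Forall Q l' /\ Forall2 R l l'.
Proof.
  induction l as [|x l IH]; intros E; [now exists []|].
  destruct (E x (or_introl eq_refl)) as (y & q & r).
  destruct IH as (l' & F & F2).
  { intros z I. apply E. now right. }
  exists (y :: l'). auto.
Qed.

Lemma game_eq_refl G : game_eq G G.
Proof. easy. Qed.

(** The induction is on the combined size because either summand may be the one that shrinks. *)
Lemma invertible_conway_game G H :
  second_player_win (add G H) -> conway_game G.
Proof.
  remember (size G + size H) as n eqn:En.
  revert G H En.
  induction n as [n IH] using (well_founded_induction Wf_nat.lt_wf).
  intros G H -> W.
  destruct (not_reducible_options G H W)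
    as [[(G' & S & Q)|(H' & S & Q)]|[HL HR]].
  - destruct (IH (size G' + size H) ltac:(lia) G' H eq_refl) as (F & C & QF).
    + now apply (second_player_win_game_eq G).
    + exists F. split; [easy|]. now apply (game_eq_trans _ G').
  - apply (IH (size G + size H') ltac:(lia) G H' eq_refl).
    apply second_player_win_add_comm.
    apply (second_player_win_game_eq H); [easy|].
    now apply second_player_win_add_comm.
  (* Each Left option other than [NInf] has an inverse among the Right options of [H]; that pair is
     smaller, so induction supplies an equal Conway form. The Right options are treated likewise. *)
  - destruct (Forall2_choice game_eq (fun K => K = NInf \/ conway_form K)
      (left_options G)) as (l' & Fl & El).
    { intros A HA. destruct (HL A HA) as [->|(C & HC & WC)].
      - exists NInf. split; [now left|apply game_eq_refl].
      - apply size_left_option in HA. apply size_right_option in HC.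
        destruct (IH (size A + size C) ltac:(lia) A C eq_refl WC) as (F & CF & QF).
        exists F. tauto. }
    destruct (Forall2_choice game_eq (fun K => K = Inf \/ conway_form K)
      (right_options G)) as (r' & Fr & Er).
    { intros A HA. destruct (HR A HA) as [->|(C & HC & WC)].
      - exists Inf. split; [now left|apply game_eq_refl].
      - apply size_right_option in HA. apply size_left_option in HC.
        destruct (IH (size A + size C) ltac:(lia) A C eq_refl WC) as (F & CF & QF).
        exists F. tauto. }
    apply second_player_win_not_terminating, add_not_terminating in W as [NG _].
    destruct G as [| |gl gls gr grs].
    { exfalso; apply NG; now left. }
    { exfalso; apply NG; now right. }
    destruct l' as [|l ls]; [now inversion El|].
    destruct r' as [|r rs]; [now inversion Er|].
    rewrite Forall_forall in Fl, Fr.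
    exists (Form l ls r rs). split.
    + now apply conway_form_intro.
    + now apply game_eq_options.
Qed.

Theorem theorem48 (G : game) :
  (invertible G <-> conway_game G) /\
  (conway_game G ->
     sum_defined G (conjugate G) /\ game_eq (add G (conjugate G)) zero).
Proof.
  split; [split|].
  - intros (H & W)%invertible_second_player_win.
    now apply (invertible_conway_game G H).
  - intros C. apply invertible_second_player_win.
    exists (conjugate G). now apply conway_game_add_conjugate.
  - intros C%conway_game_add_conjugate. split.
    + apply sum_defined_not_terminating.
      now apply second_player_win_not_terminating, add_not_terminating in C.
    + now apply second_player_win_game_eq_zero.
Qed.
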